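(* Let $\mathcal{D}=\{(v,b,r,k,\lambda)\in\mathbb{R}^5 : vr=bk,\ r(k-1)=\lambda(v-1)\}$. Every bumpy design $\Delta\in\mathcal{D}$ lies on exactly four affine lines of $\mathbb{R}^5$ that are contained in $\mathcal{D}$.
   Context: A point $\Delta=(v,b,r,k,\lambda)$ of $\mathcal{D}$ (with arbitrary real coordinates) is called a design. Consider the following seven planes, all contained in $\mathcal{D}$: $\Pi_0: b=0,\ r=0,\ \lambda=0$; $\Pi_1: b=0,\ r=0,\ v=1$; $\Pi_2: r=0,\ \lambda=0,\ k=0$; $\Pi_3: b=r=\lambda,\ v=k$; $\Pi_4: v=0,\ k=0,\ r=\lambda$; $\Pi_5: v=1,\ k=1,\ b=r$; $\Pi_6: v=1,\ k=0,\ r=0$. A design is called flat if it lies on at least one of $\Pi_0,\dots,\Pi_6$, and bumpy otherwise. *)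

(* Defs.v *)
From HB Require Import structures.
From mathcomp Require Import all_boot all_order all_algebra.
From mathcomp Require Import all_classical all_reals.

Set Implicit Arguments.
Unset Strict Implicit.
Unset Printing Implicit Defensive.

Import Order.TTheory GRing.Theory Num.Theory.

Local Open Scope classical_set_scope.
Local Open Scope ring_scope.

(* A point of R^5 is a row vector (v, b, r, k, lambda); the numerals used as
   column indices are elements of 'I_5. *)
Definition dv (R : realType) (x : 'rV[R]_5) : R := x 0 0.
Definition db (R : realType) (x : 'rV[R]_5) : R := x 0 1.
Definition dr (R : realType) (x : 'rV[R]_5) : R := x 0 2.
Definition dk (R : realType) (x : 'rV[R]_5) : R := x 0 3.
Definition dlambda (R : realType) (x : 'rV[R]_5) : R := x 0 4.

Definition designs (R : realType) : set 'rV[R]_5 :=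
  [set x | dv x * dr x = db x * dk x /\
           dr x * (dk x - 1) = dlambda x * (dv x - 1)].

Definition Pi0 (R : realType) : set 'rV[R]_5 :=
  [set x | [/\ db x = 0, dr x = 0 & dlambda x = 0]].
Definition Pi1 (R : realType) : set 'rV[R]_5 :=
  [set x | [/\ db x = 0, dr x = 0 & dv x = 1]].
Definition Pi2 (R : realType) : set 'rV[R]_5 :=
  [set x | [/\ dr x = 0, dlambda x = 0 & dk x = 0]].
Definition Pi3 (R : realType) : set 'rV[R]_5 :=
  [set x | [/\ db x = dr x, dr x = dlambda x & dv x = dk x]].
Definition Pi4 (R : realType) : set 'rV[R]_5 :=
  [set x | [/\ dv x = 0, dk x = 0 & dr x = dlambda x]].
Definition Pi5 (R : realType) : set 'rV[R]_5 :=
  [set x | [/\ dv x = 1, dk x = 1 & db x = dr x]].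
Definition Pi6 (R : realType) : set 'rV[R]_5 :=
  [set x | [/\ dv x = 1, dk x = 0 & dr x = 0]].

Definition flat (R : realType) (x : 'rV[R]_5) : Prop :=
  (@Pi0 R `|` @Pi1 R `|` @Pi2 R `|` @Pi3 R `|` @Pi4 R `|` @Pi5 R `|` @Pi6 R) x.

Definition bumpy (R : realType) (x : 'rV[R]_5) : Prop := ~ flat x.

Definition affine_line (R : realType) (n : nat) (L : set 'rV[R]_n) : Prop :=
  exists (p d : 'rV[R]_n), d != 0 /\ L = [set p + t *: d | t in [set: R]].

(* Main.v *)
Require Import Defs.
From HB Require Import structures.
From mathcomp Require Import all_boot all_order all_algebra.
From mathcomp Require Import all_classical all_reals.
From mathcomp Require Import ring lra.

Set Implicit Arguments.
Unset Strict Implicit.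
Unset Printing Implicit Defensive.

Import Order.TTheory GRing.Theory Num.Theory.

Local Open Scope classical_set_scope.
Local Open Scope card_scope.
Local Open Scope ring_scope.

(** Write Delta = (v, b, r, k, l) and let d = (a, b', c, e, f) be a direction.
    Expanding the two quadratic equations along Delta + t d shows that the line
    lies in the variety of designs iff d satisfies two linear equations that
    depend on Delta and the two quadratic equations a c = b' e and c e = f a
    ([line_dir_designs]).

    Put delta = r^2 - b l. If Delta is bumpy, then delta, r, r - l and b - r
    do not vanish ([bumpy_disc_neq0], [bumpy_coords]), and with
    c1 = (r - l) / delta and c2 = (b - r) / delta one has
      (v, k) = c1 (b, r)   and   (v - 1, k - 1) = c2 (r, l).

    The two quadratic equations in d define the union of the plane a = e = 0
    and of the cubic scroll (b', c, f) = m (a^2, a e, e^2). On the plane, the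
    linear equations leave the single direction (0, b, r, 0, l). On the scroll,
    off that plane, they factor as
      (b e - r a) (m a c1 - 1) = 0   and   (l a - r e) (m e c2 - 1) = 0.
    The factors b e - r a and l a - r e cannot vanish together, since delta is
    nonzero. Each of the three other combinations determines d up to a scalar,
    with (a, e) proportional to (b, r), (r, l) and (c2, c1) respectively
    ([bumpy_dir_complete]). These three vectors are pairwise independent, their
    determinants being delta and 1 up to sign, so the four lines are distinct
    ([bumpy_dir_not_parallel]). *)

(** * Coordinates *)

Lemma design_ext (R : realType) (x y : 'rV[R]_5) :
  dv x = dv y -> db x = db y -> dr x = dr y -> dk x = dk y ->
  dlambda x = dlambda y -> x = y.
Proof.
rewrite /dv /db /dr /dk /dlambda => h0 h1 h2 h3 h4; apply/rowP => j.
case: j => [[|[|[|[|[|j]]]]] hj] //.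
- by have -> : Ordinal hj = 0 by exact: val_inj.
- by have -> : Ordinal hj = 1 by exact: val_inj.
- by have -> : Ordinal hj = 2 by exact: val_inj.
- by have -> : Ordinal hj = 3 by exact: val_inj.
- by have -> : Ordinal hj = 4 by exact: val_inj.
Qed.

(** The vector of R^5 with the given coordinates. *)
Definition mkdesign (R : realType) (v b r k l : R) : 'rV[R]_5 :=
  \row_j [:: v; b; r; k; l]`_j.

Lemma mkdesignE (R : realType) (v b r k l : R) :
  (dv (mkdesign v b r k l) = v) * (db (mkdesign v b r k l) = b) *
  (dr (mkdesign v b r k l) = r) * (dk (mkdesign v b r k l) = k) *
  (dlambda (mkdesign v b r k l) = l).
Proof. by do !split; rewrite /dv /db /dr /dk /dlambda mxE. Qed.

Lemma coord_add_scale (R : realType) (x d : 'rV[R]_5) (t : R) :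
  (dv (x + t *: d) = dv x + t * dv d) * (db (x + t *: d) = db x + t * db d) *
  (dr (x + t *: d) = dr x + t * dr d) * (dk (x + t *: d) = dk x + t * dk d) *
  (dlambda (x + t *: d) = dlambda x + t * dlambda d).
Proof. by do !split; rewrite /dv /db /dr /dk /dlambda !mxE. Qed.

Lemma coord_scale (R : realType) (d : 'rV[R]_5) (t : R) :
  (dv (t *: d) = t * dv d) * (db (t *: d) = t * db d) *
  (dr (t *: d) = t * dr d) * (dk (t *: d) = t * dk d) *
  (dlambda (t *: d) = t * dlambda d).
Proof. by do !split; rewrite /dv /db /dr /dk /dlambda !mxE. Qed.

Lemma coord0 (R : realType) :
  (dv (0 : 'rV[R]_5) = 0) * (db (0 : 'rV[R]_5) = 0) *
  (dr (0 : 'rV[R]_5) = 0) * (dk (0 : 'rV[R]_5) = 0) *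
  (dlambda (0 : 'rV[R]_5) = 0).
Proof. by do !split; rewrite /dv /db /dr /dk /dlambda mxE. Qed.

(** * Lines through a point *)

(** The line through [x] directed by [d]; a point when [d] is zero. *)
Definition line_dir (R : realType) (n : nat) (x d : 'rV[R]_n) : set 'rV[R]_n :=
  [set x + t *: d | t in [set: R]].

Lemma line_dir_base (R : realType) (n : nat) (x d : 'rV[R]_n) :
  line_dir x d x.
Proof. by exists 0; rewrite // scale0r addr0. Qed.

Lemma line_dir_translate (R : realType) (n : nat) (p d : 'rV[R]_n) (s : R) :
  line_dir (p + s *: d) d = line_dir p d.
Proof.
apply/seteqP; split => x [t _ <-].
- by exists (s + t) => //; rewrite scalerDl addrA.
- by exists (t - s) => //; rewrite -addrA -scalerDl [s + _]addrC subrK.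
Qed.

Lemma line_dir_scale (R : realType) (n : nat) (x d : 'rV[R]_n) (s : R) :
  s != 0 -> line_dir x (s *: d) = line_dir x d.
Proof.
move=> s0; apply/seteqP; split => y [t _ <-].
- by exists (t * s) => //; rewrite scalerA.
- by exists (t / s) => //; rewrite scalerA divfK.
Qed.

Lemma affine_line_through (R : realType) (n : nat) (L : set 'rV[R]_n) x :
  affine_line L -> L x -> exists2 d, d != 0 & L = line_dir x d.
Proof.
move=> [p [d [d0 ->]]] [s _ <-]; exists d => //.
by rewrite line_dir_translate.
Qed.

Lemma line_dir_inj (R : realType) (n : nat) (x d d' : 'rV[R]_n) :
  line_dir x d = line_dir x d' -> exists s, d = s *: d'.
Proof.
move=> h; have : line_dir x d (x + d) by exists 1; rewrite ?scale1r.
by rewrite h => -[s _ /addrI <-]; exists s.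
Qed.

(** * Directions of lines contained in the variety of designs *)

(** The equations on a direction [d] obtained by equating to zero the
    coefficients of [t] and of [t ^+ 2] in the equations of designs at
    [x + t *: d], where [x] is a design. *)
Definition design_direction (R : realType) (x d : 'rV[R]_5) : Prop :=
  [/\ dv x * dr d + dr x * dv d = db x * dk d + dk x * db d,
      dr x * dk d + (dk x - 1) * dr d =
        dlambda x * dv d + (dv x - 1) * dlambda d,
      dv d * dr d = db d * dk d
    & dr d * dk d = dlambda d * dv d].

Lemma line_dir_designs (R : realType) (x d : 'rV[R]_5) : designs x ->
  line_dir x d `<=` @designs R <-> design_direction x d.
Proof.
rewrite /designs /= => -[h1 h2]; split.
- (* A polynomial of degree two in t vanishing at t = -1, 0, 1 is zero. *)
  move=> hL.
  have [p1 p2] : designs (x + 1 *: d) by apply: hL; exists 1.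
  have [m1 m2] : designs (x + (-1) *: d) by apply: hL; exists (-1).
  rewrite !coord_add_scale in p1 p2 m1 m2.
  by split; lra.
- move=> [e1 e2 e3 e4] _ [t _ <-]; rewrite /designs /= !coord_add_scale.
  split.
  + have := congr1 ( *%R t) e1; have := congr1 ( *%R (t ^+ 2)) e3; lra.
  + have := congr1 ( *%R t) e2; have := congr1 ( *%R (t ^+ 2)) e4; lra.
Qed.

(** * Coordinates of bumpy designs *)

(** A design with delta = r^2 - b l = 0 satisfies b (r - l) = r (r - l) = 0, and
    lies on one of Pi0, Pi1, Pi2, Pi3. *)
Lemma bumpy_disc_neq0 (R : realType) (x : 'rV[R]_5) :
  designs x -> bumpy x -> dr x ^+ 2 - db x * dlambda x != 0.
Proof.
rewrite /designs /bumpy /flat /=.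
set v := dv x; set b := db x; set r := dr x; set k := dk x.
set l := dlambda x => -[h1 h2] hb; apply/eqP => d0; apply: hb.
have hv : b * (r - l) = 0.
  rewrite -(mulr0 v) -d0.
  by have := congr1 ( *%R r) h1; have := congr1 ( *%R b) h2; lra.
have hk : r * (r - l) = 0.
  rewrite -(mulr0 k) -d0.
  by have := congr1 ( *%R l) h1; have := congr1 ( *%R r) h2; lra.
have [rl|rl] := eqVneq r l.
- have : r * (r - b) = 0 by rewrite -d0 rl; ring.
  move=> /eqP; rewrite mulf_eq0 subr_eq0 => /orP[/eqP r0|/eqP rb].
  + have l0 : l = 0 by rewrite -rl.
    have /eqP : b * k = 0 by rewrite -h1 r0 mulr0.
    rewrite mulf_eq0 => /orP[/eqP b0|/eqP k0].
    * by do 6 left; split.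
    * by do 4 left; right; split.
  + have [r0|r0] := eqVneq r 0.
      by do 6 left; split; rewrite -/b -/r -/l; lra.
    do 3 left; right; split => //.
    by apply: (mulIf r0); rewrite h1 rb mulrC.
- have {}rl : r - l != 0 by rewrite subr_eq0.
  move/eqP: hv; rewrite mulf_eq0 (negbTE rl) orbF => /eqP b0.
  move/eqP: hk; rewrite mulf_eq0 (negbTE rl) orbF => /eqP r0.
  have /eqP : l * (v - 1) = 0 by rewrite -h2 r0 mul0r.
  rewrite mulf_eq0 subr_eq0 => /orP[/eqP l0|/eqP v1].
  + by do 6 left; split.
  + by do 5 left; right; split.
Qed.

(** Once delta is nonzero, r, r - l and b - r vanish only on Pi6, Pi4 and Pi5
    respectively. *)
Lemma bumpy_coords (R : realType) (x : 'rV[R]_5) : designs x -> bumpy x ->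
  dr x != 0 /\ exists c1 c2 : R,
  [/\ c1 != 0, c2 != 0, dv x = c1 * db x /\ dk x = c1 * dr x
    & dv x - 1 = c2 * dr x /\ dk x - 1 = c2 * dlambda x].
Proof.
move=> hD hb; have := bumpy_disc_neq0 hD hb; move: hD hb.
rewrite /designs /bumpy /flat /=.
set v := dv x; set b := db x; set r := dr x; set k := dk x.
set l := dlambda x => -[h1 h2] hb d0.
set d := r ^+ 2 - b * l in d0.
have hv : v = b * (r - l) / d.
  apply: (mulIf d0); rewrite divfK // /d.
  by have := congr1 ( *%R r) h1; have := congr1 ( *%R b) h2; lra.
have hk : k = r * (r - l) / d.
  apply: (mulIf d0); rewrite divfK // /d.
  by have := congr1 ( *%R l) h1; have := congr1 ( *%R r) h2; lra.
split.
  apply/eqP => r0; apply: hb; right; split; rewrite -/v -/k -/r //.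
  - by apply: (mulIf d0); rewrite hv divfK // mul1r /d r0; ring.
  - by rewrite hk r0 !mul0r.
exists ((r - l) / d), ((b - r) / d); split.
- rewrite mulf_neq0 ?invr_eq0 // subr_eq0; apply/eqP => rl.
  apply: hb; do 2 left; right; split; rewrite -/v -/k //.
  + by rewrite hv rl subrr mulr0 mul0r.
  + by rewrite hk rl subrr mulr0 mul0r.
- rewrite mulf_neq0 ?invr_eq0 // subr_eq0; apply/eqP => br.
  apply: hb; left; right; split; rewrite -/v -/k //.
  + by apply: (mulIf d0); rewrite hv divfK // mul1r /d br; ring.
  + by apply: (mulIf d0); rewrite hk divfK // mul1r /d br; ring.
- by rewrite hv hk; split; ring.
- by rewrite hv hk; split; apply: (mulIf d0); rewrite mulrBl divfK // /d; field.
Qed.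

(** * The four directions *)

(** The direction (u x, x^2, x y, u y, y^2), the general point of the cubic
    scroll lying in the two quadrics a c = b' e and c e = f a. *)
Definition scroll_dir (R : realType) (u x y : R) : 'rV[R]_5 :=
  mkdesign (u * x) (x ^+ 2) (x * y) (u * y) (y ^+ 2).

(** The [i]-th direction, for [i < 4], at the design
    (c1 b, b, r, c1 r, l), where c1 b - c2 r = c1 r - c2 l = 1. *)
Definition bumpy_dir (R : realType) (b r l c1 c2 : R) (i : nat) : 'rV[R]_5 :=
  match i with
  | 0 => mkdesign 0 b r 0 l
  | 1 => scroll_dir (c2 * r) b r
  | 2 => scroll_dir (c1 * r) r l
  | _ => scroll_dir (c1 * c2) c2 c1
  end.

Lemma design_direction_bumpy (R : realType) (x : 'rV[R]_5) (c1 c2 : R) i :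
  dv x = c1 * db x -> dk x = c1 * dr x ->
  dv x - 1 = c2 * dr x -> dk x - 1 = c2 * dlambda x ->
  design_direction x (bumpy_dir (db x) (dr x) (dlambda x) c1 c2 i).
Proof.
rewrite /design_direction => hv hk hv1 hk1; rewrite hv1 hk1 hv hk.
by case: i => [|[|[|i]]]; rewrite /= !mkdesignE; split; ring.
Qed.

(** Every direction of a line of designs through a bumpy design is a multiple
    of one of the four. *)
Lemma bumpy_dir_complete (R : realType) (x d : 'rV[R]_5) (c1 c2 : R) :
  dr x ^+ 2 - db x * dlambda x != 0 ->
  dr x != 0 -> c1 != 0 -> c2 != 0 ->
  dv x = c1 * db x -> dk x = c1 * dr x ->
  dv x - 1 = c2 * dr x -> dk x - 1 = c2 * dlambda x ->
  design_direction x d ->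
  exists2 i, (i < 4)%N &
    exists s, d = s *: bumpy_dir (db x) (dr x) (dlambda x) c1 c2 i.
Proof.
rewrite /design_direction => d0 r0 c10 c20 hv hk hv1 hk1.
rewrite hv1 hk1 => -[]; move: hv1 hk1; rewrite hv hk.
set b := db x in d0 *; set r := dr x in d0 r0 *.
set l := dlambda x in d0 *.
set a := dv d; set b' := db d; set c := dr d; set e := dk d.
set f := dlambda d => n1 n2 e1 e2 q1 q2.
have [[a0 e0]|ae] := pselect (a = 0 /\ e = 0).
  exists 0%N => //; exists (c / r).
  apply: design_ext; rewrite coord_scale !mkdesignE ?mulr0 //.
  - rewrite -/b'; apply: (mulfI c10); apply: (mulIf r0).
    have -> : c1 * (c / r * b) * r = c1 * b * c by field.
    by rewrite a0 e0 in e1; lra.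
  - by rewrite divfK.
  - rewrite -/f; apply: (mulfI c20); apply: (mulIf r0).
    have -> : c2 * (c / r * l) * r = c2 * l * c by field.
    by rewrite a0 e0 in e2; lra.
(* Off the plane a = e = 0, the quadratic equations parametrize the scroll. *)
have [m [mb mc mf]] : exists m, [/\ b' = m * a ^+ 2, c = m * (a * e)
                                   & f = m * e ^+ 2].
  have [a0|a0] := eqVneq a 0.
  - have e0 : e != 0 by apply/eqP => e0; apply: ae.
    exists (f / e ^+ 2); split; last by rewrite divfK // expf_neq0.
    + apply: (mulIf e0); rewrite -q1 a0; ring.
    + apply: (mulIf e0); rewrite q2 a0; ring.
  - exists (b' / a ^+ 2).
    have hc : c = b' / a ^+ 2 * (a * e).
      by apply: (mulfI a0); rewrite q1; field.
    split => //; first by rewrite divfK // expf_neq0.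
    by apply: (mulIf a0); rewrite -q2 hc; field.
(* The linear equations factor on the scroll. *)
have /eqP : (b * e - r * a) * (m * a * c1 - 1) = 0.
  by rewrite mb mc in e1; lra.
have /eqP : (l * a - r * e) * (m * e * c2 - 1) = 0.
  by rewrite mc mf in e2; lra.
rewrite !mulf_eq0 !subr_eq0 => /orP[/eqP f2|/eqP g2] /orP[/eqP f1|/eqP g1].
(* If (a, e) = n (x, y) and the i-th direction is scroll_dir u x y, the scalar
   sought is n / u; n is read off a nonzero coordinate of (x, y). *)
- have ha : a * (r ^+ 2 - b * l) = 0.
    by have := congr1 ( *%R b) f2; have := congr1 ( *%R r) f1; lra.
  have he : e * (r ^+ 2 - b * l) = 0.
    by have := congr1 ( *%R r) f2; have := congr1 ( *%R l) f1; lra.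
  by case: ae; split; apply: (mulIf d0); rewrite mul0r.
- exists 2%N => //; exists (a / (c1 * r ^+ 2)).
  have he : e = a * l / r by apply: (mulIf r0); rewrite divfK //; lra.
  have a0 : a != 0.
    by apply: contra_eq_neq g1 => ->; rewrite mulr0 mul0r eq_sym oner_neq0.
  have hm : m = (a * c1)^-1.
    by apply: (mulIf (mulf_neq0 a0 c10)); rewrite mulVf ?mulf_neq0 // mulrA.
  apply: design_ext; rewrite coord_scale !mkdesignE.
  + by rewrite -/a; field; rewrite c10 r0.
  + by rewrite -/b' mb hm; field; rewrite ?c10 ?r0 ?a0.
  + by rewrite -/c mc he hm; field; rewrite ?c10 ?r0 ?a0.
  + by rewrite -/e he; field; rewrite ?c10 ?r0 ?a0.
  + by rewrite -/f mf he hm; field; rewrite ?c10 ?r0 ?a0.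
- exists 1%N => //; exists (e / (c2 * r ^+ 2)).
  have ha : a = e * b / r by apply: (mulIf r0); rewrite divfK //; lra.
  have e0 : e != 0.
    by apply: contra_eq_neq g2 => ->; rewrite mulr0 mul0r eq_sym oner_neq0.
  have hm : m = (e * c2)^-1.
    by apply: (mulIf (mulf_neq0 e0 c20)); rewrite mulVf ?mulf_neq0 // mulrA.
  apply: design_ext; rewrite coord_scale !mkdesignE.
  + by rewrite -/a ha; field; rewrite ?c20 ?r0 ?e0.
  + by rewrite -/b' mb ha hm; field; rewrite ?c20 ?r0 ?e0.
  + by rewrite -/c mc ha hm; field; rewrite ?c20 ?r0 ?e0.
  + by rewrite -/e; field; rewrite ?c20 ?r0 ?e0.
  + by rewrite -/f mf hm; field; rewrite ?c20 ?r0 ?e0.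
- exists 3%N => //; exists (a / (c1 * c2 ^+ 2)).
  have a0 : a != 0.
    by apply: contra_eq_neq g1 => ->; rewrite mulr0 mul0r eq_sym oner_neq0.
  have hm : m = (a * c1)^-1.
    by apply: (mulIf (mulf_neq0 a0 c10)); rewrite mulVf ?mulf_neq0 // mulrA.
  have he : e = a * c1 / c2.
    apply: (mulIf c20); rewrite divfK //.
    have : a * c1 * (m * e * c2) = a * c1 by rewrite g2 mulr1.
    by have := congr1 ( *%R (e * c2)) g1; lra.
  apply: design_ext; rewrite coord_scale !mkdesignE.
  + by rewrite -/a; field; rewrite ?c10 ?c20 ?a0.
  + by rewrite -/b' mb hm; field; rewrite ?c10 ?c20 ?a0.
  + by rewrite -/c mc he hm; field; rewrite ?c10 ?c20 ?a0.
  + by rewrite -/e he; field; rewrite ?c10 ?c20 ?a0.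
  + by rewrite -/f mf he hm; field; rewrite ?c10 ?c20 ?a0.
Qed.

Lemma scroll_dir_not_parallel (R : realType) (u x y u' x' y' s : R) :
  u != 0 -> u' != 0 -> x * y' - y * x' != 0 ->
  scroll_dir u x y <> s *: scroll_dir u' x' y'.
Proof.
move=> u0 u0' det0 h.
have := congr1 (@dv R) h; have := congr1 (@dk R) h.
rewrite !coord_scale !mkdesignE => hy hx.
have /eqP : u * u' * (x * y' - y * x') = 0.
  by have := congr1 ( *%R (u' * y')) hx; have := congr1 ( *%R (u' * x')) hy; lra.
by rewrite !mulf_eq0 (negbTE u0) (negbTE u0') (negbTE det0).
Qed.

Lemma bumpy_dir_not_parallel (R : realType) (b r l c1 c2 s : R) (i j : nat) :
  r ^+ 2 - b * l != 0 -> r != 0 -> c1 != 0 -> c2 != 0 ->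
  c1 * b - c2 * r = 1 -> c1 * r - c2 * l = 1 -> (i < j < 4)%N ->
  bumpy_dir b r l c1 c2 i <> s *: bumpy_dir b r l c1 c2 j.
Proof.
move=> d0 r0 c10 c20 n1 n2 /andP[ij j4].
have hc1r : c1 * r != 0 by rewrite mulf_neq0.
have hc2r : c2 * r != 0 by rewrite mulf_neq0.
have hcc : c1 * c2 != 0 by rewrite mulf_neq0.
case: i ij => [|i] ij.
  (* The other three directions have a nonzero v- or k-coordinate, so the
     scalar would be zero. *)
  case: j ij j4 => [//|j] _ j4 h.
  have := congr1 (@dr R) h; have := congr1 (@dv R) h; have := congr1 (@dk R) h.
  rewrite !coord_scale.
  have aux u x y : u != 0 -> (x != 0) || (y != 0) -> 0 = s * (u * y) ->
      0 = s * (u * x) -> r = s * (x * y) -> False.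
    move=> u0 xy /esym /eqP hy /esym /eqP hx hr.
    suff s0 : s = 0 by move: r0; rewrite hr s0 mul0r eqxx.
    move: hx hy; rewrite !mulf_eq0 (negbTE u0) /=.
    by case/orP: xy => /negbTE ->; rewrite orbF => /eqP // _ /eqP.
  case: j {h} j4 => [|[|[|//]]] _; rewrite /= !mkdesignE => hk hv hr.
  - by apply: (aux _ _ _ hc2r _ hk hv hr); rewrite r0 orbT.
  - by apply: (aux _ _ _ hc1r _ hk hv hr); rewrite r0.
  - by apply: (aux _ _ _ hcc _ hk hv hr); rewrite c20.
case: i ij => [|[|[|i]]]; case: j j4 => [|[|[|[|j]]]] // _ _;
  apply: scroll_dir_not_parallel => //.
- by rewrite -oppr_eq0 opprB -expr2.
- by rewrite (_ : _ - _ = 1) ?oner_neq0 //; lra.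
- by rewrite (_ : _ - _ = 1) ?oner_neq0 //; lra.
Qed.

Lemma bumpy_dir_neq0 (R : realType) (b r l c1 c2 : R) (i : nat) :
  r != 0 -> c2 != 0 -> bumpy_dir b r l c1 c2 i != 0.
Proof.
move=> r0 c20; apply/eqP; case: i => [|[|[|i]]] /= h.
- by have := congr1 (@dr R) h; rewrite mkdesignE coord0; apply/eqP.
- have := congr1 (@dlambda R) h; rewrite mkdesignE coord0.
  by apply/eqP; rewrite expf_neq0.
- have := congr1 (@db R) h; rewrite mkdesignE coord0.
  by apply/eqP; rewrite expf_neq0.
- have := congr1 (@db R) h; rewrite mkdesignE coord0.
  by apply/eqP; rewrite expf_neq0.
Qed.

(** * Counting the lines *)

Theorem theorem1 (R : realType) (Delta : 'rV[R]_5)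
    (hD : designs Delta) (hbumpy : bumpy Delta) :
  [set L : set 'rV[R]_5 | [/\ affine_line L, L `<=` @designs R & L Delta]]
    #= `I_4.
Proof.
have d0 := bumpy_disc_neq0 hD hbumpy.
have [r0 [c1 [c2 [c10 c20 [hv hk] [hv1 hk1]]]]] := bumpy_coords hD hbumpy.
set dir := bumpy_dir (db Delta) (dr Delta) (dlambda Delta) c1 c2.
have dirNpar i j s : (i < j < 4)%N -> dir i <> s *: dir j.
  apply: bumpy_dir_not_parallel => //.
  - by rewrite -hv -hv1; ring.
  - by rewrite -hk -hk1; ring.
have -> : [set L : set 'rV[R]_5 |
    [/\ affine_line L, L `<=` @designs R & L Delta]] =
    (fun i => line_dir Delta (dir i)) @` `I_4.
  apply/seteqP; split => L /=.
  - move=> [aL LD LDelta].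
    have [d dn0 hL] := affine_line_through aL LDelta.
    rewrite hL in LD.
    have /(bumpy_dir_complete d0 r0 c10 c20 hv hk hv1 hk1) :=
      (line_dir_designs d hD).1 LD.
    move=> [i i4 [s ds]]; exists i => //.
    rewrite hL ds line_dir_scale //.
    by apply: contraNneq dn0 => s0; rewrite ds s0 scale0r.
  - move=> [i i4 <-]; split; last exact: line_dir_base.
    + exists Delta, (dir i); split => //.
      exact: bumpy_dir_neq0.
    + apply/(line_dir_designs _ hD).
      exact: design_direction_bumpy.
apply: inj_card_eq => i j; rewrite !inE /= => i4 j4 hij.
have [ij|ji|//] := ltngtP i j.
- have [s hs] := line_dir_inj hij.
  by case: (@dirNpar i j s); rewrite ?ij.
- have [s hs] := line_dir_inj (esym hij).
  by case: (@dirNpar j i s); rewrite ?ji.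
Qed.
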